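(* Let $\mathcal X$ be an open subset of $\mathbb R^d$, and $\Theta\subset\mathbb R^r$. Suppose $\log p_\theta(\cdot)\in C^2(\mathcal X)$ and $m\in C^1(\mathcal X)$, and $\|\nabla_x\log p_\theta(x)\|\le f_1(x)$ for $\mathbb Q$-a.e. $x$. Suppose also that $\|\nabla_x\nabla_x\log p_\theta(x)\|\le f_2(x)$ on any compact set $C\subset\Theta$ for $\mathbb Q$-a.e. $x$, where $\|m^\top\|f_1\in L^2(\mathbb Q)$, $\|\nabla\cdot(mm^\top)\|f_1\in L^1(\mathbb Q)$, $\|mm^\top\|_\infty f_2\in L^1(\mathbb Q)$. If either $\Theta$ is compact, or $\Theta$ and $\theta\mapsto F_\theta$ are convex and $\theta_*\in\mathrm{int}(\Theta)$, then the minimum DSM estimator $\hat\theta_n$ is weakly consistent for $\theta_*$, i.e. $\hat\theta_n\to\theta_*$ in probability.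
   Context: $\{\mathbb P_\theta:\theta\in\Theta\}$ is a family of probability measures on $\mathcal X$ with positive densities $p_\theta$; $m:\mathcal X\to\mathbb R^{d\times d}$ does not depend on $\theta$; $X_1,X_2,\dots$ are i.i.d. from a probability measure $\mathbb Q$ on $\mathcal X$ with density $q$. $F_\theta(x)=\|m^\top\nabla_x\log p_\theta(x)\|_2^2+2\nabla\cdot(mm^\top\nabla\log p_\theta)(x)$, where $(\nabla\cdot A)_i=\sum_j\partial_jA_{ji}$ for matrix fields. $\int F_\theta\,d\mathbb Q$ is the $\theta$-dependent part of the diffusion score matching divergence $\mathrm{DSM}_m(\mathbb Q\|\mathbb P_\theta)=\int\|m^\top(\nabla\log q-\nabla\log p_\theta)\|_2^2\,d\mathbb Q$. The target is the (unique) minimiser $\theta_*=\mathrm{argmin}_{\theta\in\Theta}\mathrm{DSM}_m(\mathbb Q\|\mathbb P_\theta)=\mathrm{argmin}_{\theta\in\Theta}\int_{\mathcal X}F_\theta\,d\mathbb Q$, and $\hat\theta_n=\mathrm{argmin}_{\theta\in\Theta}\frac1n\sum_{i=1}^nF_\theta(X_i)$.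
   Formalization: In the case where Θ is compact, it is additionally assumed that θ ↦ F_θ(x) is continuous on Θ for Q-a.e. x; without regularity in θ the claim is false (a discontinuous relabelling of a Gaussian location family is a counterexample). *)

(* Defs.v *)
From HB Require Import structures.
From mathcomp Require Import all_boot all_order all_algebra.
From mathcomp Require Import all_classical all_reals all_analysis.

Set Implicit Arguments.
Unset Strict Implicit.
Unset Printing Implicit Defensive.

Import Order.TTheory GRing.Theory Num.Theory.
Import numFieldNormedType.Exports.

Local Open Scope classical_set_scope.
Local Open Scope ring_scope.

(* Points of R^d are row vectors 'rV[R]_d; gradients and vector fields take
   column-vector values 'cV[R]_d, so that matrix fields act on their left. *)

Definition partial (R : realType) (d : nat) (f : 'rV[R]_d -> R) (i : 'I_d)
    (x : 'rV[R]_d) : R := 'D_(delta_mx 0 i) f x.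

Definition grad (R : realType) (d : nat) (f : 'rV[R]_d -> R)
    (x : 'rV[R]_d) : 'cV[R]_d := \col_i partial f i x.

Definition hess (R : realType) (d : nat) (f : 'rV[R]_d -> R)
    (x : 'rV[R]_d) : 'M[R]_d := \matrix_(i, j) partial (partial f j) i x.

Definition div_cV (R : realType) (d : nat) (v : 'rV[R]_d -> 'cV[R]_d)
    (x : 'rV[R]_d) : R := \sum_i partial (fun y => v y i 0) i x.

(* The divergence contracts the first index: (div A)_i = sum_j d_j A_ji. *)
Definition div_mx (R : realType) (d : nat) (A : 'rV[R]_d -> 'M[R]_d)
    (x : 'rV[R]_d) : 'cV[R]_d :=
  \col_i \sum_j partial (fun y => A y j i) j x.

Definition C1_on (R : realType) (d : nat) (X : set 'rV[R]_d)
    (f : 'rV[R]_d -> R) : Prop :=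
  [/\ forall x, X x -> {for x, continuous f},
      forall i x, X x -> derivable f x (delta_mx 0 i) &
      forall i x, X x -> {for x, continuous (partial f i)}].

Definition C2_on (R : realType) (d : nat) (X : set 'rV[R]_d)
    (f : 'rV[R]_d -> R) : Prop :=
  C1_on X f /\ forall i, C1_on X (partial f i).

(* Euclidean norm of a vector, Frobenius norm of a matrix.  The library norm
   `|A| on matrices is the largest absolute value of an entry. *)
Definition norm2 (R : realType) (m n : nat) (A : 'M[R]_(m, n)) : R :=
  Num.sqrt (\sum_i \sum_j A i j ^+ 2).

Definition borel_rV (R : realType) (d : nat) :=
  g_sigma_algebraType (@open 'rV[R]_d).

(* Lebesgue measure on R^d as the d-fold product of the one-dimensional one,
   R^(d+1) being identified with R * R^d by splitting off the first
   coordinate. *)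
Fixpoint lebesgue_rV (R : realType) (d : nat) :
    set (borel_rV R d) -> \bar R :=
  match d with
  | 0 => \d_((0 : 'rV[R]_0) : borel_rV R 0)
  | d'.+1 => pushforward (@lebesgue_measure R \x @lebesgue_rV R d')%E
      (fun z => (row_mx (z.1%:M : 'rV[R]_1) (z.2 : 'rV[R]_d') :
         borel_rV R (1 + d')))
  end.

(* mu is concentrated on X, with density p with respect to Lebesgue measure;
   the values of p outside X are irrelevant. *)
Definition has_density (R : realType) (d : nat) (X : set 'rV[R]_d)
    (mu : probability (borel_rV R d) R) (p : 'rV[R]_d -> R) : Prop :=
  [/\ measurable_fun (X : set (borel_rV R d)) p,
      forall x, X x -> 0 <= p x &
      forall A : set (borel_rV R d), measurable A ->
        mu A = (\int[@lebesgue_rV R d]_(x in A `&` X) (p x)%:E)%E].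

Definition iid (R : realType) (dO dE : measure_display)
    (Omega : measurableType dO) (E : measurableType dE)
    (P : probability Omega R) (Q : probability E R)
    (X : nat -> {RV P >-> E}) : Prop :=
  (forall i (A : set E), measurable A -> distribution P (X i) A = Q A) /\
  (forall (s : seq nat) (A : nat -> set E), uniq s ->
    (forall i, measurable (A i)) ->
    P (\bigcap_(i in [set` s]) (X i @^-1` A i)) =
    (\prod_(i <- s) P (X i @^-1` A i))%E).

Definition cvg_in_probability (R : realType) (dO : measure_display)
    (Omega : measurableType dO) (P : probability Omega R) (r : nat)
    (Y : nat -> {RV P >-> borel_rV R r}) (a : 'rV[R]_r) : Prop :=
  forall e : R, 0 < e ->
    P [set w | e <= `|(Y n w : 'rV[R]_r) - a|] @[n --> \oo] --> 0%E.

Definition argmin (T : Type) (disp : Order.disp_t) (U : porderType disp)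
    (D : set T) (f : T -> U) : set T :=
  [set x | D x /\ forall y, D y -> (f x <= f y)%O].

Definition logd (R : realType) (d : nat) (p : 'rV[R]_d -> R)
    (x : 'rV[R]_d) : R := ln (p x).

Definition dsm_loss (R : realType) (d : nat) (m : 'rV[R]_d -> 'M[R]_d)
    (p : 'rV[R]_d -> R) (x : 'rV[R]_d) : R :=
  norm2 ((m x)^T *m grad (logd p) x) ^+ 2 +
  2 * div_cV (fun y => m y *m (m y)^T *m grad (logd p) y) x.

(* q is a density of Q. *)
Definition dsm (R : realType) (d : nat) (X : set 'rV[R]_d)
    (m : 'rV[R]_d -> 'M[R]_d) (Q : probability (borel_rV R d) R)
    (q p : 'rV[R]_d -> R) : \bar R :=
  (\int[Q]_(x in X)
     (norm2 ((m x)^T *m (grad (logd q) x - grad (logd p) x)) ^+ 2)%:E)%E.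

Definition dsm_risk (R : realType) (d : nat) (X : set 'rV[R]_d)
    (m : 'rV[R]_d -> 'M[R]_d) (Q : probability (borel_rV R d) R)
    (p : 'rV[R]_d -> R) : \bar R :=
  (\int[Q]_(x in X) (dsm_loss m p x)%:E)%E.

Definition emp_risk (R : realType) (d : nat) (m : 'rV[R]_d -> 'M[R]_d)
    (n : nat) (x : nat -> 'rV[R]_d) (p : 'rV[R]_d -> R) : R :=
  n%:R^-1 * \sum_(i < n) dsm_loss m p (x i).

(* The minimiser of the empirical risk need neither exist nor be unique when
   Theta is not compact: an estimator is any measurable choice of a minimiser
   on the event that there is one, with arbitrary values elsewhere. *)
Definition min_dsm_estimator (R : realType) (d r : nat)
    (dO : measure_display) (Omega : measurableType dO)
    (P : probability Omega R) (m : 'rV[R]_d -> 'M[R]_d)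
    (Theta : set 'rV[R]_r) (p : 'rV[R]_r -> 'rV[R]_d -> R)
    (X : nat -> {RV P >-> borel_rV R d})
    (thetahat : nat -> {RV P >-> borel_rV R r}) : Prop :=
  forall (n : nat) (w : Omega), (0 < n)%N ->
    let S := argmin Theta (fun theta => emp_risk m n (X^~ w) (p theta)) in
    S !=set0 -> S (thetahat n w).

(* Main.v *)
(** On X the loss is |m^T g|^2 + 2 <div (m m^T), g> + 2 <m m^T, H>, with g and H
    the gradient and Hessian of log p_theta.  It is therefore continuous in x and
    dominated, uniformly over a compact set of parameters, by a Q-integrable
    function.  Around each theta <> theta_* the infimum of the loss over a small
    ball (taken over a countable dense set, hence measurable) has, by dominated
    convergence, a mean larger than the risk of theta_*.  Covering a compact set by
    finitely many such balls and applying the weak law of large numbers to each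
    infimum, the empirical risk at theta_* is, with probability tending to 1,
    strictly smaller than at any theta of the compact set that is not close to
    theta_*.  If Theta is compact this is the claim.  In the convex case it is
    applied to a closed ball inside Theta, where the loss is continuous in theta
    because it is convex; convexity along the segments issued from theta_* then
    extends the strict inequality to all of Theta. *)
Require Import Defs.
From HB Require Import structures.
From mathcomp Require Import all_boot all_order all_algebra.
From mathcomp Require Import ring lra.
From mathcomp Require Import all_classical all_reals all_analysis measurable_realfun.
Import Order.TTheory GRing.Theory Num.Theory.
Import numFieldNormedType.Exports.
Local Open Scope classical_set_scope.
Local Open Scope ring_scope.

Set Implicit Arguments.
Unset Strict Implicit.
Unset Printing Implicit Defensive.

(** * Convergence in probability as a filter, and the weak law *)

Section with_high_probability.
Context {dO : measure_display} {Omega : measurableType dO} {R : realType}.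
Variable P : probability Omega R.

(* The sets of pairs (n, w) whose sections have (inner) probability tending to
   1 as n tends to infinity.  Being a filter, it can be used as the index of a
   near covering of a compact set. *)
Definition whp : set_system (nat * Omega) := fun S =>
  forall e : R, 0 < e -> \forall n \near \oo,
    exists B : set Omega,
      [/\ measurable B, (P B <= e%:E)%E & forall w, ~ B w -> S (n, w)].

#[global] Instance whp_filter : Filter whp.
Proof.
split.
- by move=> e e0; near=> n; exists set0; split => //; rewrite measure0 lee_fin ltW.
- move=> S T hS hT e e0; have e20 : 0 < e / 2 by rewrite divr_gt0.
  near=> n.
  have [B [mB PB BS]] : exists B : set Omega,
    [/\ measurable B, (P B <= (e / 2)%:E)%E & forall w, ~ B w -> S (n, w)].
    by near: n; exact: hS.
  have [C [mC PC CT]] : exists B : set Omega,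
    [/\ measurable B, (P B <= (e / 2)%:E)%E & forall w, ~ B w -> T (n, w)].
    by near: n; exact: hT.
  exists (B `|` C); split; first exact: measurableU.
    rewrite (le_trans (measureU2 _ _ _))// (splitr e) EFinD.
    exact: leeD.
  by move=> w /not_orP[nB nC]; split; [exact: BS|exact: CT].
- move=> S T ST hS e e0; apply: filterS (hS e e0) => n [B [mB PB BS]].
  by exists B; split => // w /BS/ST.
Unshelve. all: by end_near. Qed.

Lemma whp_ae (A : set Omega) : {ae P, forall w, A w} -> \forall z \near whp, A z.2.
Proof.
move=> [N [mN N0 AN]] e e0; near=> n; exists N; split => //.
  by rewrite N0 lee_fin ltW.
by move=> w /=; apply: contra_notP => nA; exact: AN.
Unshelve. all: by end_near. Qed.

Lemma whp_gt0 : \forall z \near whp, (0 < z.1)%N.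
Proof.
move=> e e0; near=> n; exists set0; split => //; first by rewrite measure0 lee_fin ltW.
by move=> w _ /=; near: n; exists 1%N.
Unshelve. all: by end_near. Qed.

(** Off an exceptional set of small measure [A n] does not occur, so [A n] is contained in that set.
    Measurability of [A n] then turns the inner bound into a bound on [P (A n)]. *)
Lemma whp_cvg0 (A : nat -> set Omega) : (forall n, measurable (A n)) ->
  (\forall z \near whp, ~ A z.1 z.2) -> P (A n) @[n --> \oo] --> 0%E.
Proof.
move=> mA hA.
have PA n : P (A n) \is a fin_num by rewrite fin_num_measure.
apply/fine_cvgP; split; first exact: nearW.
apply/cvgrPdist_le => e e0.
apply: filterS (hA _ e0) => n [B [mB PB BA]] /=.
rewrite sub0r normrN ger0_norm ?fine_ge0// -lee_fin fineK//.
rewrite (le_trans _ PB)// le_measure ?inE// => w Aw.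
by apply: contrapT => /BA.
Qed.

End with_high_probability.

(** * Weak law: linearity and closure under L1 approximation *)

Section weak_law.
Context {dO dE : measure_display} {Omega : measurableType dO}
  {E : measurableType dE} {R : realType}.
Variables (P : probability Omega R) (Q : probability E R).
Variable X : nat -> {RV P >-> E}.
Hypothesis iidX : iid Q X.

Lemma ge0_integral_iid (g : E -> \bar R) i : measurable_fun [set: E] g ->
  (forall x, 0 <= g x)%E -> (\int[P]_w g (X i w) = \int[Q]_x g x)%E.
Proof.
move=> mg g0; rewrite -(ge0_integral_distribution (X i) mg)//.
by apply: eq_measure_integral => A mA _; exact: (iidX.1 i).
Qed.

(** Convergence in probability of the empirical means to the mean, multiplied through by the sample
    size to avoid divisions. *)
Definition weak_law (g : E -> R) : Prop := forall e, 0 < e ->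
  \forall z \near whp P,
    `|\sum_(i < z.1) g (X i z.2) - z.1%:R * \int[Q]_x g x| <= z.1%:R * e.

Lemma weak_lawD g h : Q.-integrable [set: E] (EFin \o g) ->
  Q.-integrable [set: E] (EFin \o h) ->
  weak_law g -> weak_law h -> weak_law (fun x => g x + h x).
Proof.
move=> ig ih lg lh e e0; have e20 : 0 < e / 2 by rewrite divr_gt0.
rewrite RintegralD//.
near=> z.
rewrite big_split/= mulrDr opprD addrACA (splitr e) mulrDr.
rewrite (le_trans (ler_normD _ _))// lerD//; first by near: z; exact: lg.
by near: z; exact: lh.
Unshelve. all: by end_near. Qed.

Lemma weak_lawZ c g : Q.-integrable [set: E] (EFin \o g) ->
  weak_law g -> weak_law (fun x => c * g x).
Proof.
move=> ig lg e e0; have c0 : 0 < `|c| + 1 by rewrite ltr_wpDl.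
rewrite RintegralZl//.
near=> z.
rewrite -mulr_sumr mulrCA -mulrBr normrM.
have : `|\sum_(i < z.1) g (X i z.2) - z.1%:R * \int[Q]_x g x| <=
    z.1%:R * (e / (`|c| + 1)).
  (* Dividing by [|c| + 1] rather than [|c|] also covers [c = 0]. *)
  by near: z; apply: lg; rewrite divr_gt0.
move=> /(ler_wpM2l (normr_ge0 c))/le_trans; apply.
rewrite mulrCA ler_wpM2l// mulrA ler_pdivrMr// mulrC ler_wpM2l ?(ltW e0)//.
by rewrite lerDl.
Unshelve. all: by end_near. Qed.

(* Markov's inequality applied to the sum of the |g - s|(X_i), whose mean is
   n times the L1 distance of g and s, uniformly in n. *)
Lemma weak_law_L1_closure g : Q.-integrable [set: E] (EFin \o g) ->
  (forall e, 0 < e -> exists s, [/\ Q.-integrable [set: E] (EFin \o s),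
     (\int[Q]_x `|g x - s x|%:E <= e%:E)%E & weak_law s]) ->
  weak_law g.
Proof.
move=> ig approx e e0 delta delta0.
have e30 : 0 < e / 3 by rewrite divr_gt0.
(* The factor [1] in the minimum keeps the two means within [e / 3]; the factor [delta / 2] is the
   probability that Markov's inequality yields at level [n * (e / 3)]. *)
have [s [is_ gs ls]] : exists s, [/\ Q.-integrable [set: E] (EFin \o s),
     (\int[Q]_x `|g x - s x|%:E <= (e / 3 * Num.min 1 (delta / 2))%:E)%E & weak_law s].
  by apply: approx; rewrite mulr_gt0 ?divr_gt0// lt_min ltr01 divr_gt0.
have mgs : measurable_fun [set: E] (fun x => `|g x - s x|).
  apply: measurableT_comp => //; apply: measurable_funB.
    exact/measurable_EFinP/measurable_int/ig.
  exact/measurable_EFinP/measurable_int/is_.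
have igs : `|\int[Q]_x g x - \int[Q]_x s x| <= e / 3.
  rewrite -RintegralB// (le_trans (le_normr_Rintegral _ _))//.
    exact: (integrableB measurableT ig is_).
  rewrite -lee_fin /Rintegral fineK.
    by rewrite (le_trans gs)// lee_fin ler_piMr ?(ltW e30)// ge_min lexx.
  rewrite ge0_fin_numE ?integral_ge0//.
  by rewrite (le_lt_trans gs)// ltry.
have d20 : 0 < delta / 2 by rewrite divr_gt0.
near=> n.
have n0 : 0 < n%:R :> R by rewrite ltr0n; near: n; exists 1%N.
have [C [mC PC hC]] : exists B : set Omega,
    [/\ measurable B, (P B <= (delta / 2)%:E)%E &
     forall w, ~ B w -> `|\sum_(i < n) s (X i w) - n%:R * \int[Q]_x s x| <= n%:R * (e / 3)].
  by near: n; exact: (ls (e / 3) e30 (delta / 2) d20).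
pose D w := \sum_(i < n) `|g (X i w) - s (X i w)|.
have D_ge0 w : 0 <= D w by apply: sumr_ge0.
have mD : measurable_fun [set: Omega] D.
  apply: measurable_sum => i.
  exact: (measurableT_comp mgs (measurable_funP (X i))).
have intD : (\int[P]_w (D w)%:E = n%:R%:E * \int[Q]_x `|g x - s x|%:E)%E.
  under eq_integral do rewrite /D -sumEFin.
  rewrite ge0_integral_sum//; last first.
    by move=> i; exact/measurable_EFinP/(measurableT_comp mgs (measurable_funP (X i))).
  under eq_bigr => i _.
    rewrite (ge0_integral_iid i (g := fun x => `|g x - s x|%:E))//; last first.
      exact/measurable_EFinP.
    over.
  by rewrite sumr_const card_ord mule_natl.
have mB : measurable [set w | (n%:R * (e / 3))%:E <= `|(D w)%:E|]%E.
  rewrite -[X in measurable X]setTI; apply: emeasurable_fun_c_infty => //.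
  by apply: measurableT_comp => //; exact/measurable_EFinP.
have ne0 : 0 < n%:R * (e / 3) by rewrite mulr_gt0.
have PB : (P [set w | (n%:R * (e / 3))%:E <= `|(D w)%:E|]%E <= (delta / 2)%:E)%E.
  (* This is Markov's inequality, for the identity as the nondecreasing function. *)
  have := @le_integral_comp_abse _ _ _ P _ measurableT (EFin \o D) (n%:R * (e / 3))
    (@id (\bar R)) (@measurable_id _ _ _) (fun _ => id) (fun _ _ _ _ => id).
  have mED : measurable_fun [set: Omega] (EFin \o D) by exact/measurable_EFinP.
  rewrite setTI => /(_ mED ne0) /= h.
  rewrite -(@lee_pmul2l _ (n%:R * (e / 3))%:E)// (le_trans h)//.
  under eq_integral do rewrite ger0_norm//.
  rewrite intD -EFinM -mulrA EFinM lee_pmul2l//.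
  by rewrite (le_trans gs)// lee_fin ler_pM2l// ge_min lexx orbT.
exists (C `|` [set w | (n%:R * (e / 3))%:E <= `|(D w)%:E|]%E); split.
- exact: measurableU.
- rewrite (le_trans (measureU2 _ _ _))// (splitr delta) EFinD.
  exact: leeD.
- move=> w /not_orP[/hC /= hCw /negP]; rewrite lee_fin -ltNge ger0_norm// => Dw.
  (* Three errors, each at most [n * (e / 3)]: replacing [g] by [s] in the sample, the weak law for
     [s], and replacing [s] by [g] in the mean. *)
  have -> : \sum_(i < n) g (X i w) - n%:R * \int[Q]_x g x =
      \sum_(i < n) (g (X i w) - s (X i w)) +
      ((\sum_(i < n) s (X i w) - n%:R * \int[Q]_x s x) -
      n%:R * (\int[Q]_x g x - \int[Q]_x s x)).
    by rewrite sumrB; ring.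
  have -> : n%:R * e = n%:R * (e / 3) + (n%:R * (e / 3) + n%:R * (e / 3)) by field.
  rewrite (le_trans (ler_normD _ _))// lerD//.
    by rewrite (le_trans (ler_norm_sum _ _ _))// ltW.
  rewrite (le_trans (ler_normB _ _))// lerD//.
  by rewrite normrM ger0_norm// ler_wpM2l.
Unshelve. all: by end_near. Qed.

End weak_law.

Import HBNNSimple.

(** * The weak law for integrable functions *)

Section weak_law_integrable.
Context {dO dE : measure_display} {Omega : measurableType dO}
  {E : measurableType dE} {R : realType}.
Variables (P : probability Omega R) (Q : probability E R).
Variable X : nat -> {RV P >-> E}.
Hypothesis iidX : iid Q X.

Lemma weak_law_indic A : measurable A -> weak_law Q X (\1_A : E -> R).
Proof.
move=> mA.
pose Y i : Omega -> R := \1_(X i @^-1` A).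
have mXA i : measurable (X i @^-1` A).
  exact: measurable_funPTI.
have mY i : measurable_fun [set: Omega] (Y i) by exact: measurable_indic.
have Y1 B : measurable B -> (\1_B : Omega -> R) \in Lfun P 1%:E.
  by move=> mB; apply/Lfun1_integrable/integrable_indic; rewrite ?fin_num_measure.
have Y2 i : Y i \in Lfun P 2%:E.
  rewrite inE; apply/andP; split; rewrite inE//=.
  rewrite /finite_norm unlock/= poweR_lty//.
  under eq_integral.
    move=> w _.
    rewrite (_ : `|Y i w| `^ 2 = \1_(X i @^-1` A) w); last first.
      by rewrite /Y indicE; case: (_ \in _); rewrite ?normr1 ?normr0 ?powR1 ?powR0.
    over.
  by rewrite integral_indic// setIT (le_lt_trans (probability_le1 _ _))// ltry.
have cPX i B : measurable B -> P (X i @^-1` B) = Q B by exact: iidX.1.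
have Yfin B : measurable B -> ('E_P[\1_B : Omega -> R] = P B)%E.
  exact: expectation_indic.
have covY B C : measurable B -> measurable C ->
    covariance P (\1_B : Omega -> R) \1_C = (P (B `&` C) - P B * P C)%E.
  move=> mB mC; have mBC : measurable (B `&` C) by exact: measurableI.
  have BC : (\1_B : Omega -> R) * \1_C = \1_(B `&` C).
    by rewrite indicI.
  by rewrite covarianceE ?BC ?Y1// !Yfin.
have cov0 i j : i != j -> covariance P (Y i) (Y j) = 0%E.
  move=> ij; rewrite covY//.
  have := iidX.2 [:: i; j] (fun=> A); rewrite /= inE ij => /(_ isT (fun=> mA)).
  rewrite big_cons big_seq1 => <-.
  rewrite (_ : \bigcap_(k in _) _ = X i @^-1` A `&` X j @^-1` A).
    by rewrite subee// fin_num_measure//; exact: measurableI.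
  apply/seteqP; split=> [w h|w [h1 h2] k /=].
    by split; apply: (h _) => /=; rewrite !inE eqxx ?orbT.
  by rewrite !inE => /orP[|] /eqP ->.
have varY i : ('V_P[Y i] <= 1)%E.
  rewrite /variance covY// setIid -(fineK (fin_num_measure P _ (mXA i))).
  by rewrite -EFinM -EFinB lee_fin; nra.
pose S n : Omega -> R := \sum_(i < n) Y i.
have S2 n : S n \in Lfun P 2%:E.
  elim: n => [|n IH]; first by rewrite /S big_ord0; exact: Lfun_cst.
  by rewrite /S big_ord_recr/= rpredD ?lee1n//; exact: IH.
(* For [n <= j] the index [j] is not among the summands of [S n]. The case [j = n] drives the
   induction on the variance of [S n]. *)
have covS n j : (n <= j)%N -> covariance P (S n) (Y j) = 0%E.
  elim: n => [|n IH] nj.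
    rewrite /S big_ord0; exact: covariance_cst_l.
  rewrite /S big_ord_recr/= covarianceDl//; last exact: S2.
  by rewrite IH ?(ltnW nj)// cov0 ?add0e// neq_ltn nj.
have varS n : ('V_P[S n] <= n%:R%:E)%E.
  elim: n => [|n IH].
    by rewrite /S big_ord0 (_ : 0 = cst 0)// variance_cst.
  rewrite /S big_ord_recr/= varianceD//; last exact: S2.
  by rewrite covS// mule0 adde0 -natr1 EFinD leeD.
have ES n : ('E_P[S n] = (n%:R * fine (Q A))%:E)%E.
  elim: n => [|n IH].
    by rewrite /S big_ord0 (_ : 0 = cst 0)// expectation_cst mul0r.
  rewrite /S big_ord_recr/= expectationD/=.
  - rewrite -/(S n) IH Yfin// cPX// -natr1 mulrDl mul1r EFinD fineK//.
    by rewrite fin_num_measure.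
  - by apply: Lfun_subset12 (S2 n); rewrite fin_num_measure.
  - exact: Y1.
have QA : \int[Q]_x \1_A x = fine (Q A).
  by rewrite /Rintegral integral_indic// setIT.
move=> e e0 delta delta0.
near=> n.
have n0 : 0 < n%:R :> R by rewrite ltr0n; near: n; exists 1%N.
have mS : measurable_fun [set: Omega] (S n).
  by have := S2 n; rewrite inE => /andP[]; rewrite inE.
pose Z : {RV P >-> R} := mfun_Sub (mem_set mS).
have ne0 : 0 < n%:R * e by rewrite mulr_gt0.
have := chebyshev Z ne0.
rewrite [Z : _ -> _]/= ES /= => cheb.
exists [set w | n%:R * e <= `|S n w - n%:R * fine (Q A)|]; split.
- rewrite -[X in measurable X]setTI; apply: measurable_fun_le => //.
  by apply: measurableT_comp => //; exact: measurable_funB.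
- rewrite (le_trans cheb)// (@le_trans _ _ (((n%:R * e) ^- 2) * n%:R)%:E)//.
    by rewrite EFinM lee_pmul2l// lte_fin invr_gt0 exprn_gt0.
  (* The Chebyshev bound [n / (n * e) ^ 2] is at most [delta] as soon as [n] exceeds
     [1 / (e ^ 2 * delta)]. *)
  have ed0 : 0 < e ^+ 2 * delta by rewrite mulr_gt0// exprn_gt0.
  have n1 : (e ^+ 2 * delta)^-1 <= n%:R by near: n; exact: nbhs_infty_ger.
  rewrite lee_fin ler_pdivrMl ?exprn_gt0//.
  rewrite -[leLHS]mulr1 exprMn (expr2 n%:R) -!mulrA ler_pM2l//.
  by move: n1; rewrite -div1r ler_pdivrMr// (expr2 e) -!mulrA.
- move=> w /negP; rewrite -ltNge QA => /ltW; congr (_ <= _); congr (`|_ - _|).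
  by rewrite /S fct_sumE.
Unshelve. all: by end_near. Qed.

(** Integrability is carried along because the sum and scaling rules for [weak_law] require it of
    their arguments. *)
Let integrable_law g := Q.-integrable [set: E] (EFin \o g) /\ weak_law Q X g.

Let integrable_lawD g h : integrable_law g -> integrable_law h ->
  integrable_law (fun x => g x + h x).
Proof.
move=> [ig lg] [ih lh]; split; last exact: weak_lawD.
exact: (integrableD measurableT ig ih).
Qed.

Let integrable_lawZ c g : integrable_law g -> integrable_law (fun x => c * g x).
Proof.
move=> [ig lg]; split; last exact: weak_lawZ.
exact: (integrableZl measurableT c ig).
Qed.

Let integrable_law_indic A : measurable A -> integrable_law (\1_A : E -> R).
Proof.
move=> mA; split; last exact: weak_law_indic.
by apply: integrable_indic; rewrite ?fin_num_measure.
Qed.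

Let integrable_law_nnsfun (s : {nnsfun E >-> R}) : integrable_law s.
Proof.
rewrite (funext (fimfunEord s)).
elim: (index_enum _) => [|i r IH].
(* The empty sum is seen as [0] times an indicator. *)
- rewrite (_ : (fun _ => _) = fun x => 0 * \1_setT x); last first.
    by apply/funext => x; rewrite mul0r big_nil.
  exact/integrable_lawZ/integrable_law_indic.
- under eq_fun do rewrite big_cons.
  apply: integrable_lawD IH; apply/integrable_lawZ/integrable_law_indic.
  exact: measurable_funPTI.
Qed.

(** Positive and negative parts reduce this to [f >= 0]. Simple functions increasing to [f] converge
    to it in L1 by dominated convergence, and the law passes from them to [f] by L1 closure. *)
Lemma weak_law_integrable g : Q.-integrable [set: E] (EFin \o g) -> weak_law Q X g.
Proof.
suff pos f : Q.-integrable [set: E] (EFin \o f) -> (forall x, 0 <= f x) ->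
    weak_law Q X f.
  move=> ig.
  have [ip iN] : Q.-integrable [set: E] (EFin \o g^\+) /\
     Q.-integrable [set: E] (EFin \o g^\-).
    by split; [exact: integrable_funrpos|exact: integrable_funrneg].
  rewrite (_ : g = fun x => g^\+ x + (-1) * g^\- x); last first.
    by apply/funext => x; rewrite mulN1r -[in LHS](funrposBneg g).
  by apply: (integrable_lawD _ (integrable_lawZ _ _)).2; split => //;
    apply: pos => // x; rewrite ?funrpos_ge0 ?funrneg_ge0.
move=> if_ f0; apply: weak_law_L1_closure => // e e0.
have mf := measurable_int _ if_.
have f0' x : [set: E] x -> (0 <= (EFin \o f) x)%E by move=> _; rewrite lee_fin.
pose s := nnsfun_approx measurableT mf.
have sf x : [set: E] x -> (EFin \o s ^~ x) @ \oo --> (EFin \o f) x.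
  by move=> Tx; exact: cvg_nnsfun_approx.
have ms n : measurable_fun [set: E] (EFin \o s n) by exact/measurable_EFinP.
have les x n : [set: E] x -> (`|(EFin \o s n) x| <= (EFin \o f) x)%E.
  by move=> Tx; rewrite /= ger0_norm// nnsfun_approxE; exact: le_approx.
have [_ cvg0 _] := dominated_convergence measurableT ms mf (aeW _ sf) if_ (aeW _ les).
have /fine_cvgP[Ifin /cvgrPdist_lt/(_ _ e0) Ie] := cvg0.
near \oo => n.
have In : (\int[Q]_x `|(s n x)%:E - (f x)%:E|)%E \is a fin_num by near: n.
have : `|0 - fine (\int[Q]_x `|(s n x)%:E - (f x)%:E|)%E| < e by near: n.
rewrite sub0r normrN ger0_norm ?fine_ge0 ?integral_ge0// => Ine.
exists (s n); split; [exact: (integrable_law_nnsfun _).1| |exact: (integrable_law_nnsfun _).2].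
rewrite (_ : (\int[Q]_x _)%E = \int[Q]_x `|(s n x)%:E - (f x)%:E|)%E.
  by rewrite -(fineK In) lee_fin ltW.
by apply: eq_integral => x _; rewrite -EFinB /= distrC.
Unshelve. all: by end_near. Qed.

(** A deviation of at most half the mean leaves a sum of at least [n] times half the mean. *)
Lemma weak_law_gt0 g : Q.-integrable [set: E] (EFin \o g) ->
  0 < \int[Q]_x g x -> \forall z \near whp P, 0 < \sum_(i < z.1) g (X i z.2).
Proof.
move=> ig g0; near=> z.
have n0 : 0 < z.1%:R :> R by rewrite ltr0n; near: z; exact: whp_gt0.
have : `|\sum_(i < z.1) g (X i z.2) - z.1%:R * \int[Q]_x g x| <=
    z.1%:R * (\int[Q]_x g x / 2).
  by near: z; apply: (weak_law_integrable ig); rewrite divr_gt0.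
rewrite ler_distl => /andP[+ _]; apply: lt_le_trans.
by rewrite -mulrBr mulr_gt0// subr_gt0 ltr_pdivrMr// ltr_pMr// ltr1n.
Unshelve. all: by end_near. Qed.

End weak_law_integrable.

(** * Wald's argument on a compact parameter set *)

(** The preimages of a [Q]-null set under the countably many [X i] are [P]-null, hence so is their
    union: one null event serves all indices. *)
Lemma ae_iid (dO dE : measure_display) (Omega : measurableType dO)
    (E : measurableType dE) (R : realType) (P : probability Omega R)
    (Q : probability E R) (X : nat -> {RV P >-> E}) (A : set E) :
  iid Q X -> {ae Q, forall x, A x} -> {ae P, forall w i, A (X i w)}.
Proof.
move=> iidX [N [mN N0 AN]].
have : P.-negligible (\bigcup_i (X i @^-1` N)).
  apply: negligible_bigcup => i; exists (X i @^-1` N); split => //.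
    exact: measurable_funPTI.
  by rewrite -N0; exact: iidX.1.
apply: negligibleS => w /= /existsNP[i nA]; exists i => //.
exact: AN.
Qed.

(** For each rational centre and each radius [1 / (n + 1)], a point of [C] in that ball is chosen if
    there is one, and [t0] otherwise. This makes the sequence lie in [C] itself. *)
Lemma dense_sequence (R : realType) (r : nat) (C : set 'rV[R]_r) (t0 : 'rV[R]_r) :
  C t0 -> exists D : nat -> 'rV[R]_r, (forall j, C (D j)) /\
    forall t (U : set 'rV[R]_r), C t -> nbhs t U -> exists j, U (D j).
Proof.
move=> Ct0.
pose c (i : 'rV[rat]_r * nat) :=
  xget t0 (C `&` ball (map_mx ratr i.1 : 'rV[R]_r) i.2.+1%:R^-1).
have Cc i : C (c i) by rewrite /c; case: xgetP => [y _ []|].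
exists (fun j => if unpickle j is Some i then c i else t0); split.
  by move=> j; case: unpickle.
move=> t U Ct /nbhs_ballP[e /= e0 eU].
have e20 : 0 < e / 2 by rewrite divr_gt0.
near \oo => n.
have ne : n.+1%:R^-1 < e / 2 by near: n; exact: near_infty_natSinv_lt (PosNum e20).
have n0 : 0 < n.+1%:R^-1 :> R by rewrite invr_gt0.
have /choice[v vt] j : exists q : rat, ball (t ord0 j) n.+1%:R^-1 (ratr q).
  have [|q] := @rat_in_itvoo R (t ord0 j - n.+1%:R^-1) (t ord0 j + n.+1%:R^-1).
    by rewrite ltrD2l gt0_cp.
  by rewrite in_itv/= => qt; exists q; rewrite -ball_normE/= distrC ltr_distl.
pose w := \row_j v j.
have wt : ball (map_mx ratr w : 'rV[R]_r) n.+1%:R^-1 t.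
  split=> // i j; rewrite !mxE; apply: ball_sym; rewrite (ord1 i); exact: vt.
exists (pickle (w, n)); rewrite pickleK.
have : ball (map_mx ratr w : 'rV[R]_r) n.+1%:R^-1 (c (w, n)).
  by rewrite /c; case: xgetP => [y _ []|/(_ t) []].
move=> cw; apply: eU; rewrite /= (splitr e).
apply: (@ball_triangle _ _ (map_mx ratr w : 'rV[R]_r)).
  by apply: ball_sym; apply: le_ball wt; exact: ltW.
by apply: le_ball cw; exact: ltW.
Unshelve. all: by end_near. Qed.

Lemma within_continuous_dist (R : realType) (T : topologicalType) (C : set T)
    (f : T -> R) : {within C, continuous f} -> forall t e, C t -> 0 < e ->
  \forall u \near t, C u -> `|f t - f u| < e.
Proof.
move=> /subspace_continuousP cf t e Ct e0.
by have /cvgrPdist_lt/(_ _ e0) := cf t Ct.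
Qed.

(** The domination holds only almost everywhere; dominated convergence, applied to the constant
    sequence [f], accepts this and returns integrability of the limit. *)
Lemma ae_le_integrable (d : measure_display) (T : measurableType d)
    (R : realType) (mu : {measure set T -> \bar R}) (f g : T -> R) :
  measurable_fun [set: T] f -> {ae mu, forall x, `|f x| <= g x} ->
  mu.-integrable [set: T] (EFin \o g) -> mu.-integrable [set: T] (EFin \o f).
Proof.
move=> mf fg ig.
have mEf : measurable_fun [set: T] (EFin \o f) by exact/measurable_EFinP.
have cst_cvg : {ae mu, forall x, [set: T] x ->
    (EFin \o f) x @[_ --> \oo] --> (EFin \o f) x}.
  by apply: aeW => x _; exact: cvg_cst.
have dom : {ae mu, forall x (n : nat), [set: T] x ->
    (`|(EFin \o f) x| <= (EFin \o g) x)%E}.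
  by apply: filterS fg => x fgx _ _; rewrite /= lee_fin.
by have [] := dominated_convergence measurableT (fun=> mEf) mEf cst_cvg ig dom.
Qed.

(** * An integrable lower bound of the loss near one parameter *)

Section local_lower_bound.
Context {dE : measure_display} {E : measurableType dE} {R : realType} {r : nat}.
Variables (Q : probability E R) (F : 'rV[R]_r -> E -> R) (C : set 'rV[R]_r).
Variable G : E -> R.
Hypothesis mF : forall t, C t -> measurable_fun [set: E] (F t).
Hypothesis FG : forall t, C t -> {ae Q, forall x, `|F t x| <= G x}.
Hypothesis iG : Q.-integrable [set: E] (EFin \o G).
Hypothesis Fcont : {ae Q, forall x, {within C, continuous (F ^~ x)}}.

(** The function [h] is the infimum of the loss over the points of a dense sequence in a small ball
    around [t]. As the radius shrinks these infima tend to [F t] almost everywhere, hence in mean,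
    so one of them has mean above [c]. Continuity extends its lower bound from the sequence to all
    of [C] in the ball. *)
Lemma local_lower_bound t c : C t -> c < \int[Q]_x F t x ->
  exists h : E -> R, [/\ Q.-integrable [set: E] (EFin \o h), c < \int[Q]_x h x &
    exists2 e, 0 < e & {ae Q, forall x u, C u -> ball t e u -> h x <= F u x}].
Proof.
move=> Ct ct; have [D [CD denseD]] := dense_sequence Ct.
have mG : measurable_fun [set: E] G by exact/measurable_EFinP/measurable_int/iG.
(* Points of the sequence outside the ball are replaced by [t], so that the infimum runs over all
   [j]. *)
pose u (k j : nat) : E -> R :=
  if `[< ball t k.+1%:R^-1 (D j) >] then F (D j) else F t.
(* Truncation at [- G] bounds the family below at every [x], as measurability of the infimum
   requires; almost everywhere it changes nothing, by [wu]. *)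
pose w k j x := Num.max (u k j x) (- G x).
pose phi k x := infs (fun j => w k j x) 0%N.
have phiE k x : phi k x = inf (range (fun j => w k j x)).
  by rewrite /phi /infs/=; congr inf; apply/seteqP; split => [_ [j _ <-]|_ [j _ <-]]; exists j.
have w_lb k x : lbound (range (fun j => w k j x)) (- G x).
  by move=> _ [j _ <-]; rewrite /w le_max lexx orbT.
have w_hl k x : has_lbound (range (fun j => w k j x)) by exists (- G x).
have mphi k : measurable_fun [set: E] (phi k).
  apply: measurable_fun_infs => [x _|j]; first exact: w_hl.
  apply: measurable_maxr; last exact: measurableT_comp.
  by rewrite /u; case: ifP => _; exact: mF.
have phi_ge k x : - G x <= phi k x.
  by rewrite phiE; apply: lb_le_inf => //; exists (w k 0%N x); exists 0%N.
have phi_le k j x : phi k x <= w k j x by rewrite phiE; apply: ge_inf => //; exists j.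
have wu : {ae Q, forall x, forall k j, w k j x = u k j x /\ u k j x <= G x}.
  have : {ae Q, forall x, forall j, `|F (D j) x| <= G x} by apply: ae_foralln => j; exact: FG.
  apply: filterS2 (FG Ct) => x Ftx FDx k j.
  have /ler_normlP[uG Gu] : `|u k j x| <= G x by rewrite /u; case: ifP.
  by split => //; apply/max_idPl; rewrite lerNl.
have phi_cvg : {ae Q, forall x, [set: E] x -> (EFin \o phi k) x @[k --> \oo] --> (EFin \o F t) x}.
  apply: filterS2 wu Fcont => x wux cx _ /=.
  apply: cvg_EFin; first exact: nearW.
  apply/cvgrPdist_le => e e0.
  have /nbhs_ballP[d /= d0 dt] := within_continuous_dist cx Ct e0.
  near=> k.
  have kd : k.+1%:R^-1 < d by near: k; exact: (near_infty_natSinv_lt (PosNum d0)).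
  rewrite ler_distlC; apply/andP; split.
    rewrite phiE; apply: lb_le_inf; first by exists (w k 0%N x); exists 0%N.
    move=> _ [j _ <-]; rewrite (wux _ _).1 /u; case: asboolP => [tD|_].
      have := dt (D j) (le_ball (ltW kd) tD) (CD j).
      by rewrite ltr_distlC => /andP[/ltW].
    by rewrite gerBl ltW.
  rewrite (le_trans (phi_le k 0%N x))// (wux _ _).1 /u; case: asboolP => [tD|_].
    have := dt (D 0%N) (le_ball (ltW kd) tD) (CD 0%N).
    by rewrite ltr_distlC => /andP[_ /ltW].
  by rewrite lerDl ltW.
have phi_G : {ae Q, forall x k, [set: E] x -> (`|(EFin \o phi k) x| <= (EFin \o G) x)%E}.
  apply: filterS2 wu (FG Ct) => x wux Ftx k _.
  rewrite /= lee_fin ler_norml phi_ge/= (le_trans (phi_le k 0%N x))//.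
  by have [-> ] := wux k 0%N.
have mEphi k : measurable_fun [set: E] (EFin \o phi k) by exact/measurable_EFinP.
have mEF : measurable_fun [set: E] (EFin \o F t) by exact/measurable_EFinP/mF.
have iphi k : Q.-integrable [set: E] (EFin \o phi k).
  apply: ae_le_integrable iG => //.
  by apply: filterS phi_G => x /(_ k Logic.I); rewrite /= lee_fin.
have [_ _ int_cvg] := dominated_convergence measurableT mEphi mEF phi_cvg iG phi_G.
have iF : Q.-integrable [set: E] (EFin \o F t).
  by apply: ae_le_integrable iG; [exact: mF|exact: FG].
have /fine_cvgP[_ Rint_cvg] : (\int[Q]_x (phi k x)%:E)%E @[k --> \oo] -->
    (\int[Q]_x F t x)%:E.
  by rewrite /Rintegral fineK//; exact: integrable_fin_num.
have [k _ kP] := cvgr_gt _ Rint_cvg _ ct.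
exists (phi k); split => //; first exact: (kP k (leqnn k)).
exists k.+1%:R^-1 => //.
apply: filterS2 wu Fcont => x wux cx v Cv tv.
apply/ler_addgt0Pr => e e0.
(* Some [D j] lies in the open ball around [t] and close enough to [v] for [F (D j) x] to be within
   [e] of [F v x]. *)
have /denseD : nbhs v ([set y | C y -> `|F v x - F y x| < e] `&` ball t k.+1%:R^-1).
  apply: filterI; first exact: (within_continuous_dist cx Cv e0).
  by apply: open_nbhs_nbhs; split => //; exact: ball_open.
move=> /(_ Cv)[j [Fj tj]].
rewrite (le_trans (phi_le k j x))// (wux _ _).1 /u asboolT//.
by have := Fj (CD j); rewrite ltr_distlC => /andP[_ /ltW].
Unshelve. all: by end_near. Qed.

End local_lower_bound.

Lemma dist_continuous (R : realType) (V : normedModType R) (a : V) :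
  continuous (fun t : V => `|t - a|).
Proof.
by move=> t; apply: cvg_norm; apply: cvgB; [exact: cvg_id|exact: cvg_cst].
Qed.

Section strict_minimiser.
Context {dO dE : measure_display} {Omega : measurableType dO}
  {E : measurableType dE} {R : realType} {r : nat}.
Variables (P : probability Omega R) (Q : probability E R).
Variable X : nat -> {RV P >-> E}.
Hypothesis iidX : iid Q X.
Variables (F : 'rV[R]_r -> E -> R) (C : set 'rV[R]_r) (t0 : 'rV[R]_r) (G : E -> R).
Hypothesis compactC : compact C.
Hypothesis Ct0 : C t0.
Hypothesis mF : forall t, C t -> measurable_fun [set: E] (F t).
Hypothesis FG : forall t, C t -> {ae Q, forall x, `|F t x| <= G x}.
Hypothesis iG : Q.-integrable [set: E] (EFin \o G).
Hypothesis Fcont : {ae Q, forall x, {within C, continuous (F ^~ x)}}.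
Hypothesis min_t0 : forall t, C t -> t != t0 ->
  \int[Q]_x F t0 x < \int[Q]_x F t x.

(* Wald's argument: near each t <> t0 the empirical means are bounded below by
   that of a single function of mean larger than the minimum; finitely many
   such neighbourhoods cover the compact set. *)
Lemma whp_strict_minimiser e : 0 < e -> \forall z \near whp P,
  forall t, C t -> e <= `|t - t0| ->
    \sum_(i < z.1) F t0 (X i z.2) < \sum_(i < z.1) F t (X i z.2).
Proof.
move=> e0.
pose K := C `&` [set t | e <= `|t - t0|].
have cK : compact K.
  apply: compact_closedI => //.
  have : closed ((fun t : 'rV[R]_r => `|t - t0|) @^-1` [set y | e <= y]).
    apply: preimage_closed => [t _|]; last exact: closed_ge.
    exact: dist_continuous.
  by [].
have /compact_near_coveringP ncK := cK.
have iF t : C t -> Q.-integrable [set: E] (EFin \o F t).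
  by move=> Ct; apply: ae_le_integrable iG; [exact: mF|exact: FG].
(* The guard [C t] is needed because the neighbourhoods of the covering are balls, which may leave
   [C]. *)
pose better (z : nat * Omega) t := C t ->
    \sum_(i < z.1) F t0 (X i z.2) < \sum_(i < z.1) F t (X i z.2).
have whpK : \forall z \near whp P, K `<=` better z.
  (* With [whp] as the index filter, near covering leaves a local claim: a ball around each [t] in
     [K] on which one event of high probability suffices. *)
  apply: ncK.
  move=> t [Ct /= et].
  have tt0 : t != t0 by apply: contraTneq et => ->; rewrite subrr normr0 -ltNge.
  have [h [ih mh [d d0 hd]]] := local_lower_bound mF FG iG Fcont Ct (min_t0 Ct tt0).
  have ihF : Q.-integrable [set: E] (EFin \o (fun x => h x - F t0 x)).
    exact: (integrableB measurableT ih (iF _ Ct0)).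
  have mhF : 0 < \int[Q]_x (h x - F t0 x).
    by rewrite RintegralB ?subr_gt0//; exact: iF.
  exists (ball t d, [set z | 0 < \sum_(i < z.1) (h (X i z.2) - F t0 (X i z.2)) /\
      forall i u, C u -> ball t d u -> h (X i z.2) <= F u (X i z.2)]).
    split; first exact: nbhsx_ballx.
    apply: filterS2 (weak_law_gt0 iidX ihF mhF) (whp_ae (ae_iid iidX hd)).
    by move=> z; split.
  move=> [u z] [/= tu [sum_gt0 hF]] Cu.
  rewrite -subr_gt0 -sumrB (lt_le_trans sum_gt0)// ler_sum// => i _.
  by rewrite lerB// hF.
near=> z => t Ct et.
have Kz : K `<=` better z by near: z.
exact: (Kz t (conj Ct et) Ct).
Unshelve. all: by end_near.
Qed.

End strict_minimiser.

(** * Convex functions on R^r *)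

Lemma mx_entry_le (R : realType) k l (B : 'M[R]_(k, l)) i j : `|B i j| <= `|B|.
Proof.
rewrite [leRHS]/Num.norm /= mx_normrE.
by apply/bigmax_geP; right; exists (i, j).
Qed.

Lemma convex_setP (R : realType) (V : lmodType R) (S : set V) : convex_set S ->
  forall x y t, S x -> S y -> 0 <= t <= 1 -> S (t *: x + (1 - t) *: y).
Proof.
move=> cS x y t Sx Sy /andP[t0 t1].
by have := cS x y (Itv01 t0 t1) (mem_set Sx) (mem_set Sy); rewrite inE.
Qed.

Lemma convex_functionP (R : realType) (V : lmodType R) (S : set V) (f : V -> R) :
  convex_function S f -> forall x y t, S x -> S y -> 0 <= t <= 1 ->
  f (t *: x + (1 - t) *: y) <= t * f x + (1 - t) * f y.
Proof.
move=> cf x y t Sx Sy /andP[t0 t1].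
exact: (cf (Itv01 t0 t1) x y (mem_set Sx) (mem_set Sy)).
Qed.

Section convex_continuous.
Context {R : realType} {r : nat}.
Variables (S : set 'rV[R]_r) (f : 'rV[R]_r -> R) (t0 : 'rV[R]_r).
Hypothesis cS : @convex_set R 'rV[R]_r S.
Hypothesis cf : @convex_function R 'rV[R]_r S f.

Let ray v t : S t0 -> S (t0 + v) -> 0 <= t <= 1 ->
  S (t0 + t *: v) /\ f (t0 + t *: v) - f t0 <= t * (f (t0 + v) - f t0).
Proof.
move=> S0 Sv t01.
have -> : t0 + t *: v = t *: (t0 + v) + (1 - t) *: t0.
  by rewrite scalerDr scalerBl scale1r [RHS]addrC addrA subrK.
split; first exact: convex_setP.
have := convex_functionP cf Sv S0 t01; lra.
Qed.

(** The point [t0 + (u + v)] is the midpoint of [t0 + 2 *: u] and [t0 + 2 *: v], so that two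
    directions can be treated separately. *)
Let mid u v : S (t0 + 2 *: u) -> S (t0 + 2 *: v) ->
  S (t0 + (u + v)) /\
  f (t0 + (u + v)) <= 2^-1 * f (t0 + 2 *: u) + 2^-1 * f (t0 + 2 *: v).
Proof.
move=> Su Sv.
have half : 0 <= (2^-1 : R) <= 1 by lra.
have -> : t0 + (u + v) = 2^-1 *: (t0 + 2 *: u) + (1 - 2^-1) *: (t0 + 2 *: v).
  rewrite (_ : 1 - 2^-1 = 2^-1 :> R); last by field.
  rewrite !scalerDr !scalerA mulVf// !scale1r addrACA -scalerDl.
  by rewrite (_ : 2^-1 + 2^-1 = 1 :> R) ?scale1r//; field.
split; first exact: convex_setP.
have := convex_functionP cf Su Sv half.
by rewrite {2}(_ : 1 - 2^-1 = 2^-1 :> R)//; field.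
Qed.

Let e_ i : 'rV[R]_r := delta_mx 0 i.

Variable rho : R.
Hypothesis rho0 : 0 < rho.
Hypothesis S_axis : forall i, S (t0 + rho *: e_ i) /\ S (t0 - rho *: e_ i).
Hypothesis St0 : S t0.

(** A single nonnegative bound for the increments of [f] at the [2 * r] axis points at distance
    [rho] from [t0]. *)
Let L := \sum_i (`|f (t0 + rho *: e_ i) - f t0| + `|f (t0 - rho *: e_ i) - f t0|).

(** The sign of [a] selects the axis point towards which the chord bound [ray] is used, with
    parameter [|a| / rho]. *)
Let axis i a : `|a| <= rho ->
  S (t0 + a *: e_ i) /\ f (t0 + a *: e_ i) - f t0 <= `|a| / rho * L.
Proof.
move=> arho; have [Sp Sn] := S_axis i.
have t01 : 0 <= `|a| / rho <= 1.
  by rewrite divr_ge0 ?(ltW rho0)//= ler_pdivrMr// mul1r.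
have LP : f (t0 + rho *: e_ i) - f t0 <= L /\ f (t0 - rho *: e_ i) - f t0 <= L.
  rewrite /L (bigD1 i)//=; set T := \sum_(_ | _) _.
  have T0 : 0 <= T by apply: sumr_ge0 => j _; rewrite addr_ge0.
  move: (ler_norm (f (t0 + rho *: e_ i) - f t0)) (normr_ge0 (f (t0 + rho *: e_ i) - f t0)).
  move: (ler_norm (f (t0 - rho *: e_ i) - f t0)) (normr_ge0 (f (t0 - rho *: e_ i) - f t0)).
  lra.
have [a0|a0] := leP 0 a.
  have [SS ff] := ray St0 Sp t01.
  have aE : `|a| / rho *: (rho *: e_ i) = a *: e_ i.
    by rewrite scalerA divfK ?gt_eqF// ger0_norm.
  rewrite aE in SS ff; split=> //; rewrite (le_trans ff)// ler_wpM2l//; [lra|exact: LP.1].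
have [SS ff] := ray St0 Sn t01.
have aE : `|a| / rho *: - (rho *: e_ i) = a *: e_ i.
  by rewrite scalerN scalerA divfK ?gt_eqF// ltr0_norm// scaleNr opprK.
rewrite aE in SS ff; split=> //; rewrite (le_trans ff)// ler_wpM2l//; [lra|exact: LP.2].
Qed.

Let L0 : 0 <= L. Proof. by apply: sumr_ge0 => i _; rewrite addr_ge0. Qed.

(* Splitting off one coordinate at a time by midpoint convexity halves the
   admissible increment, whence the factors 2 ^ size s. *)
Let increment (s : seq 'I_r) (a : 'I_r -> R) eta : 0 <= eta -> (forall i, `|a i| <= eta) ->
  2 ^+ size s * eta <= rho ->
  S (t0 + \sum_(i <- s) a i *: e_ i) /\
  f (t0 + \sum_(i <- s) a i *: e_ i) - f t0 <= 2 ^+ size s * eta * (L / rho).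
Proof.
elim: s a eta => [|i s IH] a eta eta0 a_eta /=.
  rewrite big_nil addr0 subrr expr0 mul1r => _; split => //.
  by rewrite mulr_ge0// ?divr_ge0 ?(ltW rho0).
rewrite exprS big_cons => srho.
have sum2 : 2 *: (\sum_(j <- s) a j *: e_ j) = \sum_(j <- s) (2 * a j) *: e_ j.
  by rewrite scaler_sumr; apply: eq_bigr => j _; rewrite scalerA.
have [S1 f1] : S (t0 + 2 *: (\sum_(j <- s) a j *: e_ j)) /\
    f (t0 + 2 *: (\sum_(j <- s) a j *: e_ j)) - f t0 <=
    2 ^+ size s * (2 * eta) * (L / rho).
  rewrite sum2; apply: IH => [|j|]; first by rewrite mulr_ge0.
    by rewrite normrM ger0_norm// ler_wpM2l.
  by rewrite mulrCA mulrA.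
have pow1 : 1 <= 2 ^+ size s :> R by rewrite exprn_ege1// ler1n.
have a2 : `|2 * a i| <= 2 * eta by rewrite normrM ger0_norm// ler_wpM2l.
have eta2 : 2 * eta <= 2 * 2 ^+ size s * eta.
  by rewrite ler_wpM2r// ler_peMr.
have [S2 f2] : S (t0 + 2 *: (a i *: e_ i)) /\
    f (t0 + 2 *: (a i *: e_ i)) - f t0 <= `|2 * a i| / rho * L.
  by rewrite scalerA; apply: axis; rewrite (le_trans a2)// (le_trans eta2).
have [S3 f3] := mid S2 S1; split => //.
have f2' : `|2 * a i| / rho * L <= 2 ^+ size s * (2 * eta) * (L / rho).
  rewrite mulrAC -mulrA ler_wpM2r ?divr_ge0 ?(ltW rho0)// (le_trans a2)//.
  by rewrite mulrCA mulrA.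
rewrite -!mulrA (mulrA (2 ^+ _)) in f1 f2' *; lra.
Qed.

Let K := 2 ^+ r * (L / rho).

Let increment_norm h : 2 ^+ r * `|h| <= rho ->
  S (t0 + h) /\ f (t0 + h) - f t0 <= K * `|h|.
Proof.
move=> hrho; have h_eta i : `|h 0 i| <= `|h| by exact: mx_entry_le.
have sz : size (index_enum 'I_r) = r by rewrite /index_enum -enumT size_enum_ord.
have := increment (s := index_enum _) (normr_ge0 h) h_eta.
rewrite sz -row_sum_delta => /(_ hrho)[Sh fh]; split => //.
by rewrite (le_trans fh)// /K mulrAC.
Qed.

(** [increment_norm] bounds the growth of [f] from above, linearly with slope [K]. The same bound at
    the reflected point [t0 + (t0 - u)], combined with midpoint convexity, gives the matching bound
    from below. *)
Lemma convex_continuous_at : continuous_at t0 f.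
Proof.
have K0 : 0 <= K by rewrite mulr_ge0 ?exprn_ge0// divr_ge0 ?(ltW rho0).
apply/(@cvgrPdist_lt _ _ _ (nbhs t0) (nbhs_filter t0)) => e e0.
(* The first term keeps the increment admissible for [increment_norm]; the second makes
   [K * |u - t0|] smaller than [e], also when [K = 0]. *)
have d0 : 0 < Num.min (rho / 2 ^+ r) (e / (K + 1)).
  by rewrite lt_min !divr_gt0 ?exprn_gt0// ltr_wpDl.
apply/nbhs_ballP; exists (Num.min (rho / 2 ^+ r) (e / (K + 1))) => //= u.
rewrite -ball_normE /= lt_min distrC => /andP[u_rho u_e].
have hrho : 2 ^+ r * `|u - t0| <= rho.
  by rewrite mulrC -ler_pdivlMr ?exprn_gt0// ltW.
have [Su fu] := increment_norm hrho.
have hrho' : 2 ^+ r * `|t0 - u| <= rho by rewrite distrC.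
have [Sv fv] := increment_norm hrho'.
have half : 0 <= (2^-1 : R) <= 1 by lra.
have := convex_functionP cf Su Sv half.
rewrite (_ : _ *: _ + _ *: _ = t0); last first.
  rewrite (_ : 1 - 2^-1 = 2^-1 :> R); last by field.
  rewrite -scalerDr addrACA -[u - t0]opprB addNr addr0 scalerDr -scalerDl.
  by rewrite (_ : 2^-1 + 2^-1 = 1 :> R) ?scale1r//; field.
have uE : t0 + (u - t0) = u by rewrite addrC subrK.
rewrite uE in fu *.
rewrite [`|t0 - u|]distrC in fv => mid_le.
have small : K * `|u - t0| < e.
  rewrite (le_lt_trans (y := (K + 1) * `|u - t0|))//.
    by rewrite ler_wpM2r// lerDl.
  by rewrite mulrC -ltr_pdivlMr// ltr_wpDl.
by rewrite ltr_norml; apply/andP; split; lra.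
Qed.

End convex_continuous.

(** * The score matching loss *)

Lemma continuous_at_sum (R : realType) (T : topologicalType) (I : Type) (s : seq I)
    (f : I -> T -> R) x :
  (forall i, continuous_at x (f i)) ->
  continuous_at x (fun y => \sum_(i <- s) f i y).
Proof.
move=> cf; elim: s => [|i s IH].
  under eq_fun do rewrite big_nil.
  exact: cst_continuous.
under eq_fun do rewrite big_cons.
by apply: continuousD; [exact: cf|exact: IH].
Qed.

(** * Calculus and measurability for C1 functions on an open set *)

Section C1_closure.
Context {R : realType} {d : nat}.
Variable X : set 'rV[R]_d.
Hypothesis openX : open X.

(** The differentiation rules hold only at points of [X]; since [X] is open, this is enough to
    transfer continuity at a point of [X]. *)
Lemma continuous_near_eq (f g : 'rV[R]_d -> R) x : X x ->
  (forall y, X y -> f y = g y) -> {for x, continuous f} -> {for x, continuous g}.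
Proof.
move=> Xx fg cf; rewrite /prop_for /continuous_at -(fg x Xx).
have fgx : {near x, f =1 g} :=
  @filterS _ _ (nbhs_filter x) _ _ fg (open_nbhs_nbhs (conj openX Xx)).
exact: cvg_trans (near_eq_cvg fgx) cf.
Qed.

Lemma partialD (f g : 'rV[R]_d -> R) i x :
  derivable f x (delta_mx 0 i) -> derivable g x (delta_mx 0 i) ->
  partial (fun y => f y + g y) i x = partial f i x + partial g i x.
Proof. by move=> df dg; rewrite /partial deriveD. Qed.

Lemma partialM (f g : 'rV[R]_d -> R) i x :
  derivable f x (delta_mx 0 i) -> derivable g x (delta_mx 0 i) ->
  partial (fun y => f y * g y) i x = partial f i x * g x + f x * partial g i x.
Proof. move=> df dg; apply: etrans (deriveM df dg) _.
by rewrite addrC; congr (_ + _); exact: mulrC. Qed.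

Lemma C1_onD (f g : 'rV[R]_d -> R) : C1_on X f -> C1_on X g ->
  C1_on X (fun y => f y + g y).
Proof.
move=> [cf df pf] [cg dg pg]; split=> [x Xx|i x Xx|i x Xx].
- by apply: continuousD; [exact: cf|exact: cg].
- by apply: derivableD; [exact: df|exact: dg].
- apply: (continuous_near_eq (f := fun y => partial f i y + partial g i y)) => //.
    by move=> y Xy; rewrite partialD//; [exact: df|exact: dg].
  by apply: continuousD; [exact: pf|exact: pg].
Qed.

Lemma C1_onM (f g : 'rV[R]_d -> R) : C1_on X f -> C1_on X g ->
  C1_on X (fun y => f y * g y).
Proof.
move=> [cf df pf] [cg dg pg]; split=> [x Xx|i x Xx|i x Xx].
- by apply: continuousM; [exact: cf|exact: cg].
- by apply: derivableM; [exact: df|exact: dg].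
- apply: (continuous_near_eq (f := fun y => partial f i y * g y + f y * partial g i y)) => //.
    by move=> y Xy; rewrite partialM//; [exact: df|exact: dg].
  apply: continuousD; apply: continuousM; [exact: pf|exact: cg|exact: cf|exact: pg].
Qed.

Lemma partial_cst (c : R) i (x : 'rV[R]_d) : partial (fun=> c) i x = 0.
Proof. exact: derive_cst. Qed.

Lemma C1_on_cst (c : R) : C1_on X (fun=> c).
Proof.
split=> [x Xx|i x Xx|i x Xx]; first exact: cst_continuous.
  exact: derivable_cst.
rewrite (_ : partial _ i = fun=> 0); first exact: cst_continuous.
by apply/funext => y; exact: partial_cst.
Qed.

Lemma C1_on_sum (I : Type) (s : seq I) (f : I -> 'rV[R]_d -> R) :
  (forall i, C1_on X (f i)) -> C1_on X (fun y => \sum_(i <- s) f i y).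
Proof.
move=> C1f; elim: s => [|i s IH].
  under eq_fun do rewrite big_nil.
  exact: C1_on_cst.
under eq_fun do rewrite big_cons.
exact: C1_onD.
Qed.

Lemma partial_sum (I : Type) (s : seq I) (f : I -> 'rV[R]_d -> R) i x : X x ->
  (forall k, C1_on X (f k)) ->
  partial (fun y => \sum_(k <- s) f k y) i x = \sum_(k <- s) partial (f k) i x.
Proof.
move=> Xx C1f; elim: s => [|k s IH].
  rewrite big_nil; under eq_fun do rewrite big_nil.
  exact: partial_cst.
rewrite big_cons -IH; under eq_fun do rewrite big_cons.
have [_ dk _] := C1f k; have [_ ds _] := C1_on_sum s C1f.
by rewrite partialD//; [exact: dk|exact: ds].
Qed.

(** The part in [X] of the preimage of an open interval is open, because [X] is open and [f] is
    continuous at each of its points; extension by zero keeps measurability. *)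
Lemma measurable_restrict_continuous (f : 'rV[R]_d -> R) :
  (forall x, X x -> {for x, continuous f}) ->
  measurable_fun [set: borel_rV R d] (f \_ X).
Proof.
move=> cf.
have mX : measurable (X : set (borel_rV R d)) by exact: sub_sigma_algebra.
apply/(measurable_restrictT _ mX) => _ ; apply: (measurability _ (RGenOpens.measurableE R)).
  2: exact: mX.
move=> _ [_ [a [b ->]] <-]; apply: sub_sigma_algebra.
rewrite openE => x [Xx fx].
apply: (@filterI _ _ (nbhs_filter x)); first exact: open_nbhs_nbhs.
by apply: cf => //; apply: open_nbhs_nbhs; split => //; exact: interval_open.
Qed.

End C1_closure.

(** * Expansion, continuity and bound of the loss *)

Section loss.
Context {R : realType} {d : nat}.
Variable X : set 'rV[R]_d.
Hypothesis openX : open X.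
Variable m : 'rV[R]_d -> 'M[R]_d.
Hypothesis m_C1 : forall i j, C1_on X (fun x => m x i j).

Let A (x : 'rV[R]_d) := m x *m (m x)^T.

Let A_C1 i j : C1_on X (fun x => A x i j).
Proof.
under eq_fun do rewrite mxE.
by apply: C1_on_sum => // k; under eq_fun do rewrite mxE; exact: C1_onM.
Qed.

Lemma norm2_ge0 k l (B : 'M[R]_(k, l)) : 0 <= norm2 B.
Proof. exact: sqrtr_ge0. Qed.

Lemma norm2_sqr k l (B : 'M[R]_(k, l)) : norm2 B ^+ 2 = \sum_i \sum_j B i j ^+ 2.
Proof. by rewrite sqr_sqrtr// sumr_ge0// => i _; rewrite sumr_ge0// => j _; exact: sqr_ge0. Qed.

Lemma entry_le_norm2 k l (B : 'M[R]_(k, l)) i j : `|B i j| <= norm2 B.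
Proof.
rewrite -(ler_pXn2r (n := 2)) ?nnegrE ?norm2_ge0// norm2_sqr real_normK ?num_real//.
rewrite (bigD1 i)//= (bigD1 j)//= -addrA lerDl addr_ge0// sumr_ge0// => a _.
  exact: sqr_ge0.
by rewrite sumr_ge0// => b _; exact: sqr_ge0.
Qed.

Lemma normr_mulmx_le k l n (B : 'M[R]_(k, l)) (C : 'M[R]_(l, n)) i j b c :
  (forall s, `|B i s| <= b) -> (forall s, `|C s j| <= c) ->
  `|(B *m C) i j| <= l%:R * (b * c).
Proof.
move=> Bb Cc; rewrite mxE (le_trans (ler_norm_sum _ _ _))//.
rewrite mulr_natl -[X in _ *+ X](card_ord l) -sumr_const ler_sum// => s _.
by rewrite normrM ler_pM.
Qed.

Section one_density.
Variable p : 'rV[R]_d -> R.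
Hypothesis logp_C2 : C2_on X (logd p).

(** The product rule on each entry of [A *m grad] separates the derivatives of [A] from those of the
    gradient. *)
Lemma dsm_lossE x : X x -> dsm_loss m p x =
  norm2 ((m x)^T *m grad (logd p) x) ^+ 2 +
  2 * (((div_mx A x)^T *m grad (logd p) x) 0 0 +
       \sum_i \sum_j A x i j * hess (logd p) x i j).
Proof.
have [[_ _ _] partial_C1] := logp_C2.
move=> Xx; congr (_ + 2 * _).
have partialAg i : partial (fun y => (A y *m grad (logd p) y) i 0) i x =
    \sum_j (partial (fun y => A y i j) i x * grad (logd p) x j 0 +
            A x i j * hess (logd p) x i j).
  rewrite (_ : (fun _ => _) =
      fun y => \sum_j A y i j * partial (logd p) j y); last first.
    by apply/funext => y; rewrite mxE; apply: eq_bigr => j _; rewrite [grad _ _ _ _]mxE.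
  rewrite (partial_sum openX)//; last by move=> k; apply: C1_onM.
  apply: eq_bigr => j _; have [_ dA _] := A_C1 i j; have [_ dl _] := partial_C1 j.
  by rewrite partialM ?[grad _ _ _ _]mxE ?[hess _ _ _ _]mxE//; [exact: dA|exact: dl].
rewrite /div_cV (eq_bigr _ (fun i _ => partialAg i)).
under eq_bigr do rewrite big_split.
(* After the exchange the inner sum over [i] of the derivatives of [A i j] is the [j]-th entry of
   [div_mx A]. *)
rewrite big_split/= exchange_big/=; congr (_ + _).
rewrite mxE; apply: eq_bigr => j _.
by rewrite !mxE mulr_suml.
Qed.

Lemma dsm_loss_continuous x : X x -> {for x, continuous (dsm_loss m p)}.
Proof.
have [[cl dl pl] partial_C1] := logp_C2.
move=> Xx; apply: (continuous_near_eq openX Xx) (fun y Xy => esym (dsm_lossE Xy)) _.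
have cg j : continuous_at x (fun y => grad (logd p) y j 0).
  rewrite (_ : (fun _ => _) = partial (logd p) j); first exact: pl.
  by apply/funext => y; rewrite mxE.
have ch i j : continuous_at x (fun y => hess (logd p) y i j).
  rewrite (_ : (fun _ => _) = partial (partial (logd p) j) i).
    by have [_ _ c] := partial_C1 j; exact: c.
  by apply/funext => y; rewrite mxE.
have cA i j : continuous_at x (fun y => A y i j) by have [c _ _] := A_C1 i j; exact: c.
have cdiv j : continuous_at x (fun y => div_mx A y j 0).
  rewrite (_ : (fun _ => _) = fun y => \sum_i partial (fun z => A z i j) i y).
    by apply: continuous_at_sum => i; have [_ _ c] := A_C1 i j; exact: c.
  by apply/funext => y; rewrite mxE.
apply: (@continuousD R R^o).
  rewrite (_ : (fun _ => _) = fun y =>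
      \sum_i \sum_(j < 1) (\sum_k m y k i * grad (logd p) y k j) ^+ 2); last first.
    apply/funext => y; rewrite norm2_sqr; apply: eq_bigr => i _.
    by apply: eq_bigr => j _; rewrite mxE; under eq_bigr do rewrite mxE.
  apply: continuous_at_sum => i; apply: continuous_at_sum => j; rewrite (ord1 j).
  have cs : continuous_at x (fun y => \sum_k m y k i * grad (logd p) y k 0).
    by apply: continuous_at_sum => k; apply: continuousM; [have [c _ _] := m_C1 k i; exact: c|exact: cg].
  exact: (continuousM cs cs).
apply: continuousM; first exact: cst_continuous.
apply: continuousD.
  rewrite (_ : (fun _ => _) = fun y =>
      \sum_j div_mx A y j 0 * grad (logd p) y j 0); last first.
    by apply/funext => y; rewrite mxE; under eq_bigr do rewrite mxE.
  by apply: continuous_at_sum => j; apply: continuousM; [exact: cdiv|exact: cg].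
by apply: continuous_at_sum => i; apply: continuous_at_sum => j;
  apply: continuousM; [exact: cA|exact: ch].
Qed.

Lemma measurable_dsm_loss :
  measurable_fun [set: borel_rV R d] (dsm_loss m p \_ X).
Proof. exact: (measurable_restrict_continuous openX dsm_loss_continuous). Qed.

(** Every product is bounded entrywise, whence the powers of [d]: each of the [d] entries of [m^T g]
    is at most [d * (norm2 m^T * a)], and [A] and the Hessian have [d ^ 2] entries each. The right
    side combines only quantities assumed integrable in the consistency theorem. *)
Lemma dsm_loss_le x a b : X x ->
  norm2 (grad (logd p) x) <= a -> norm2 (hess (logd p) x) <= b ->
  `|dsm_loss m p x| <= d%:R ^+ 3 * (norm2 (m x)^T * a) ^+ 2 +
    2 * (d%:R * (norm2 (div_mx A x) * a) + d%:R ^+ 2 * (`|A x| * b)).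
Proof.
move=> Xx ga hb; rewrite (dsm_lossE Xx) (le_trans (ler_normD _ _))//.
have g_le j : `|grad (logd p) x j 0| <= a by rewrite (le_trans (entry_le_norm2 _ _ _)).
have h_le i j : `|hess (logd p) x i j| <= b by rewrite (le_trans (entry_le_norm2 _ _ _)).
apply: lerD.
  rewrite ger0_norm ?exprn_ge0 ?norm2_ge0// norm2_sqr.
  rewrite (_ : d%:R ^+ 3 * _ = \sum_(i < d) (d%:R * (norm2 (m x)^T * a)) ^+ 2); last first.
    by rewrite sumr_const card_ord -mulr_natl; ring.
  apply: ler_sum => i _; rewrite big_ord1.
  rewrite -[leLHS]real_normK ?num_real//.
  have h : `|((m x)^T *m grad (logd p) x) i 0| <= d%:R * (norm2 (m x)^T * a).
    by apply: normr_mulmx_le => // s; exact: entry_le_norm2.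
  by rewrite ler_pXn2r ?nnegrE// (le_trans _ h).
rewrite normrM ger0_norm// ler_wpM2l// (le_trans (ler_normD _ _))// lerD//.
  by apply: normr_mulmx_le => // s; rewrite mxE; exact: entry_le_norm2.
rewrite (le_trans (ler_norm_sum _ _ _))//.
rewrite (_ : d%:R ^+ 2 * _ = \sum_(i < d) \sum_(j < d) `|A x| * b); last first.
  by rewrite !sumr_const card_ord -mulrnA -[RHS]mulr_natl natrM expr2.
apply: ler_sum => i _; rewrite (le_trans (ler_norm_sum _ _ _))//.
apply: ler_sum => j _; rewrite normrM ler_pM//.
exact: mx_entry_le.
Qed.

End one_density.
End loss.

(** * Consistency *)

Lemma compact_norm_ball (R : realType) r (a : 'rV[R]_r) (rho : R) :
  compact [set u : 'rV[R]_r | `|u - a| <= rho].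
Proof.
apply: bounded_closed_compact.
  exists (`|a| + rho); split; first exact: num_real.
  move=> M /ltW aM u /= urho; apply: le_trans aM.
  by rewrite -[u](subrK a) (le_trans (ler_normD _ _))// addrC lerD2l.
have : closed ((fun u : 'rV[R]_r => `|u - a|) @^-1` [set y | y <= rho]).
  apply: preimage_closed; last exact: closed_le.
  by move=> u _; exact: dist_continuous.
by [].
Qed.

Lemma lt_of_lt_conv (R : realType) (t x y : R) : 0 < t ->
  y < t * x + (1 - t) * y -> y < x.
Proof.
move=> t0; rewrite mulrBl mul1r addrCA -subr_gt0 addrAC subrr add0r -mulrBr.
by rewrite pmulr_rgt0// subr_gt0.
Qed.

Section consistency.
Context {R : realType} {d r : nat}.
Variables (X : set 'rV[R]_d) (Theta : set 'rV[R]_r).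
Variables (m : 'rV[R]_d -> 'M[R]_d) (p : 'rV[R]_r -> 'rV[R]_d -> R).
Variable Q : probability (borel_rV R d) R.
Context {dO : measure_display} {Omega : measurableType dO}.
Variables (P : probability Omega R) (Xs : nat -> {RV P >-> borel_rV R d}).
Variables (thetastar : 'rV[R]_r) (thetahat : nat -> {RV P >-> borel_rV R r}).
Variable f1 : 'rV[R]_d -> R.
Hypothesis openX : open X.
Hypothesis Xs_in_X : forall i w, X (Xs i w).
Hypothesis Xs_iid : iid Q Xs.
Hypothesis argmin_risk :
  argmin Theta (fun theta => dsm_risk X m Q (p theta)) = [set thetastar].
Hypothesis estimator : min_dsm_estimator m Theta p Xs thetahat.
Hypothesis logp_C2 : forall theta, Theta theta -> C2_on X (logd (p theta)).
Hypothesis m_C1 : forall i j, C1_on X (fun x => m x i j).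
Hypothesis grad_le : forall theta, Theta theta ->
  {ae Q, forall x, X x -> norm2 (grad (logd (p theta)) x) <= f1 x}.
Hypothesis f1_L2 : ((fun x => norm2 (m x)^T * f1 x) \_ X) \in Lfun Q 2%:E.
Hypothesis f1_L1 :
  ((fun x => norm2 (div_mx (fun y => m y *m (m y)^T) x) * f1 x) \_ X) \in Lfun Q 1%:E.
Hypothesis hess_le : forall C : set 'rV[R]_r, compact C -> C `<=` Theta ->
  exists f2 : 'rV[R]_d -> R,
    (forall theta, C theta ->
       {ae Q, forall x, X x -> norm2 (hess (logd (p theta)) x) <= f2 x}) /\
    ((fun x => `|m x *m (m x)^T| * f2 x) \_ X) \in Lfun Q 1%:E.

(** Extension by zero off [X] yields measurable functions on the whole space, to which the weak law
    applies. *)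
Let F theta : borel_rV R d -> R := dsm_loss m (p theta) \_ X.

Let FE theta x : X x -> F theta x = dsm_loss m (p theta) x.
Proof. by move=> Xx; rewrite /F patchE mem_set. Qed.

(** The envelope depends on [C] through [f2] only and is common to all of [C], while the exceptional
    null set may vary with [theta]. *)
Let envelope (C : set 'rV[R]_r) : compact C -> C `<=` Theta ->
  exists2 G : borel_rV R d -> R, Q.-integrable [set: borel_rV R d] (EFin \o G) &
    forall theta, C theta -> {ae Q, forall x, `|F theta x| <= G x}.
Proof.
move=> cC CT; have [f2 [f2_ge f2_L1]] := hess_le cC CT.
pose N := (fun x => norm2 (m x)^T * f1 x) \_ X.
pose D := (fun x => norm2 (div_mx (fun y => m y *m (m y)^T) x) * f1 x) \_ X.
pose H := (fun x => `|m x *m (m x)^T| * f2 x) \_ X.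
exists (fun x => d%:R ^+ 3 * N x ^+ 2 + 2 * (d%:R * D x + d%:R ^+ 2 * H x)).
  have iN := Lfun2_integrable_sqr f1_L2.
  have /Lfun1_integrable iD := f1_L1.
  have /Lfun1_integrable iH := f2_L1.
  have mT := @measurableT _ (borel_rV R d).
  exact: (integrableD mT (integrableZl mT (d%:R ^+ 3) iN)
    (integrableZl mT 2 (integrableD mT (integrableZl mT d%:R iD)
      (integrableZl mT (d%:R ^+ 2) iH)))).
move=> theta Ct; apply: (@filterS2 (borel_rV R d) (almost_everywhere Q) _ _ _ _ _ (grad_le (CT _ Ct))
  (f2_ge _ Ct)) => x gx hx.
have [Xx|nXx] := pselect (X x); last first.
  by rewrite /F /N /D /H !patchE memNset// normr0 expr0n !mulr0 addr0 mulr0 addr0.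
rewrite FE// /N /D /H !patchE mem_set//.
by apply: (dsm_loss_le openX m_C1 (logp_C2 (CT _ Ct)) Xx (gx Xx) (hx Xx)).
Qed.

Let mF theta : Theta theta -> measurable_fun [set: borel_rV R d] (F theta).
Proof. by move=> Tt; exact: (measurable_dsm_loss openX m_C1 (logp_C2 Tt)). Qed.

Let iF theta : Theta theta -> Q.-integrable [set: borel_rV R d] (EFin \o F theta).
Proof.
(* A singleton is a compact set of parameters. *)
move=> Tt; have [|G iG FG] := @envelope [set theta] (@compact_set1 _ _).
  by move=> _ ->.
by apply: ae_le_integrable iG; [exact: mF|exact: FG].
Qed.

Let Ttstar : Theta thetastar.
Proof.
have : [set thetastar] thetastar by [].
by rewrite -argmin_risk => -[].
Qed.

Let riskE theta : Theta theta ->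
  dsm_risk X m Q (p theta) = (\int[Q]_x F theta x)%:E.
Proof.
move=> Tt; rewrite /Rintegral fineK; last exact: integrable_fin_num (iF Tt).
rewrite /dsm_risk [LHS]integral_mkcond; congr integral; apply/funext => x.
by rewrite /F !patchE; case: ifP.
Qed.

(** A parameter whose risk does not exceed that of [thetastar] would be a minimiser too, against
    uniqueness. *)
Let risk_lt theta : Theta theta -> theta != thetastar ->
  \int[Q]_x F thetastar x < \int[Q]_x F theta x.
Proof.
move=> Tt tt.
have min_le y : Theta y -> \int[Q]_x F thetastar x <= \int[Q]_x F y x.
  move=> Ty; have : [set thetastar] thetastar by [].
  rewrite -argmin_risk => -[_ /(_ y Ty)].
  by rewrite (riskE Ttstar) (riskE Ty).
rewrite ltNge; apply/negP => le_star.
suff : [set thetastar] theta by move=> /= tE; rewrite tE eqxx in tt.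
rewrite -argmin_risk.
split; first exact: Tt.
move=> y Ty.
rewrite (riskE Tt) (riskE Ty) lee_fin.
exact: le_trans le_star (min_le y Ty).
Qed.

Let loss_sum n w theta : R := \sum_(i < n) dsm_loss m (p theta) (Xs i w).

Let sumF n w theta : \sum_(i < n) F theta (Xs i w) = loss_sum n w theta.
Proof. by apply: eq_bigr => i _; exact: (FE theta (Xs_in_X i w)). Qed.

Let ltF n w theta theta' :
  \sum_(i < n) F theta (Xs i w) < \sum_(i < n) F theta' (Xs i w) ->
  loss_sum n w theta < loss_sum n w theta'.
Proof. by rewrite -!sumF. Qed.

Let loss_sum_le n w theta theta' : (0 < n)%N ->
  emp_risk m n (Xs ^~ w) (p theta) <= emp_risk m n (Xs ^~ w) (p theta') ->
  loss_sum n w theta <= loss_sum n w theta'.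
Proof. by move=> n0; rewrite /emp_risk ler_pM2l// invr_gt0 ltr0n. Qed.

Let le_loss_sum n w theta theta' : loss_sum n w theta <= loss_sum n w theta' ->
  emp_risk m n (Xs ^~ w) (p theta) <= emp_risk m n (Xs ^~ w) (p theta').
Proof. by move=> le; rewrite /emp_risk ler_wpM2l// invr_ge0 ler0n. Qed.

(** * Consistency from a compact neighbourhood of the minimiser *)

Section compact_neighbourhood.
Variables (C : set 'rV[R]_r) (rho : R).
Hypothesis compactC : compact C.
Hypothesis CTheta : C `<=` Theta.
Hypothesis rho0 : 0 < rho.
Hypothesis Cnear : forall theta, Theta theta -> `|theta - thetastar| < rho -> C theta.
Hypothesis cont : {ae Q, forall x, X x ->
  {within C, continuous (fun theta => dsm_loss m (p theta) x)}}.
Hypothesis extend : forall n w e, 0 < e <= rho ->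
  (forall theta, C theta -> e <= `|theta - thetastar| ->
     loss_sum n w thetastar < loss_sum n w theta) ->
  forall theta, Theta theta -> e <= `|theta - thetastar| ->
     loss_sum n w thetastar < loss_sum n w theta.

(** With high probability [thetastar] strictly beats every parameter at distance at least [e], first
    in [C], then in [Theta] by [extend]. An empirical minimiser exists on that event, so the
    estimator is one and cannot be far from [thetastar]. *)
Lemma consistency_compact_neighbourhood : cvg_in_probability thetahat thetastar.
Proof.
(* Capping at [rho] makes [extend] applicable and puts all parameters outside [C] at distance at
   least [e]. *)
move=> e0' e0'_gt0; pose e := Num.min e0' rho.
have e0 : 0 < e by rewrite lt_min e0'_gt0.
have e_rho : 0 < e <= rho by rewrite e0 ge_min lexx orbT.
have Cstar : C thetastar by apply: Cnear => //; rewrite subrr normr0.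
have [G iG FG] := envelope compactC CTheta.
have Fcont : {ae Q, forall x, {within C, continuous (F ^~ x)}}.
  apply: (@filterS (borel_rV R d) (almost_everywhere Q) _ _ _ _ cont) => x cx.
  have [Xx|nXx] := pselect (X x).
    rewrite (_ : F ^~ x = fun theta => dsm_loss m (p theta) x); first exact: cx.
    by apply/funext => theta; exact: FE.
  rewrite (_ : F ^~ x = fun=> 0).
    by apply: continuous_subspaceT => ?; exact: cst_continuous.
  by apply/funext => theta; rewrite /F patchE memNset.
have strict := whp_strict_minimiser Xs_iid compactC Cstar
  (fun theta Ct => mF (CTheta Ct)) FG iG Fcont
  (fun theta Ct => risk_lt (CTheta Ct)) e0.
have cont_w := whp_ae (ae_iid Xs_iid cont).
apply: whp_cvg0.
  move=> n; apply: (measurable_funPTI (thetahat n)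
    (Y := [set u : 'rV[R]_r | e0' <= `|u - thetastar|])).
  rewrite -[X in measurable X]setCK; apply: measurableC; apply: sub_sigma_algebra.
  have : open ((fun u : 'rV[R]_r => `|u - thetastar|) @^-1` [set y | y < e0']).
    apply: open_comp => [u _|]; [exact: dist_continuous|exact: open_lt].
  by congr open; apply/seteqP; split => u /=; rewrite ltNge => /negP.
near=> z; move=> /= hat_far.
have n0 : (0 < z.1)%N by near: z; exact: whp_gt0.
have cont_z i : {within C, continuous (fun theta => dsm_loss m (p theta) (Xs i z.2))}.
  have : forall i, X (Xs i z.2) ->
    {within C, continuous (fun theta => dsm_loss m (p theta) (Xs i z.2))}.
    by near: z.
  by apply; exact: Xs_in_X.
have strict_z : forall theta, Theta theta -> e <= `|theta - thetastar| ->
    loss_sum z.1 z.2 thetastar < loss_sum z.1 z.2 theta.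
  apply: extend => // theta Ct et.
  have : forall t, C t -> e <= `|t - thetastar| ->
    \sum_(i < z.1) F thetastar (Xs i z.2) < \sum_(i < z.1) F t (Xs i z.2).
    by near: z.
  move=> /(_ theta Ct et).
  exact: ltF.
(* The continuous empirical loss attains its minimum over [C]. This point also minimises over
   [Theta], since outside [C] the loss exceeds that of [thetastar]. *)
have [c Cc c_min] : exists2 c, C c & forall t, C t -> loss_sum z.1 z.2 c <= loss_sum z.1 z.2 t.
  have [c|c cC cmin] := @compact_EVT_min _ R (loss_sum z.1 z.2) C (ex_intro _ _ Cstar) compactC.
    by apply: continuous_at_sum => i; exact: cont_z.
  exists c; first by rewrite inE in cC.
  by move=> t Ct; apply: cmin; rewrite inE.
have c_argmin : argmin Theta (fun theta => emp_risk m z.1 (Xs ^~ z.2) (p theta)) c.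
  split; first exact: CTheta.
  move=> y Ty; apply: le_loss_sum.
  have [Cy|nCy] := pselect (C y); first exact: c_min.
  apply: (le_trans (c_min _ Cstar)); apply: ltW; apply: strict_z; first exact: Ty.
  apply: (@le_trans _ _ rho); first by rewrite ge_min lexx orbT.
  by rewrite leNgt; apply/negP => /(Cnear Ty)/nCy.
have [That hat_min] := estimator n0 (ex_intro _ _ c_argmin).
have hat_le := loss_sum_le n0 (hat_min _ Ttstar).
have : e <= `|thetahat z.1 z.2 - thetastar| by rewrite (le_trans _ hat_far)// ge_min lexx.
by move=> /(strict_z _ That); rewrite ltNge hat_le.
Unshelve. all: by end_near. Qed.

End compact_neighbourhood.

(** With [C] equal to [Theta] the extension is trivial, and the radius [1] is arbitrary. *)
Lemma consistency_compact : compact Theta ->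
  {ae Q, forall x, X x ->
    {within Theta, continuous (fun theta => dsm_loss m (p theta) x)}} ->
  cvg_in_probability thetahat thetastar.
Proof.
move=> cT contT.
exact: (@consistency_compact_neighbourhood Theta 1).
Qed.

Lemma consistency_convex : @convex_set R 'rV[R]_r Theta ->
  (forall x, X x -> @convex_function R 'rV[R]_r Theta
     (fun theta => dsm_loss m (p theta) x)) ->
  Theta° thetastar -> cvg_in_probability thetahat thetastar.
Proof.
move=> cT closs /nbhs_ballP[eps /= eps0 ballT].
(* Since [2 * rho < eps], steps of length [rho] along the axes from any point of the ball [C] stay
   in [Theta], as continuity of convex functions there requires. *)
pose rho := eps / 3; have rho0 : 0 < rho by rewrite divr_gt0.
pose C := [set u : 'rV[R]_r | `|u - thetastar| <= rho].
have near_Theta u : `|u - thetastar| <= 2 * rho -> Theta u.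
  move=> u_rho; apply: ballT; rewrite -ball_normE /= distrC (le_lt_trans u_rho)//.
  by rewrite /rho; lra.
have CT : C `<=` Theta.
  by move=> u /= Cu; apply: near_Theta; rewrite (le_trans Cu)// ler_peMl ?ler1n// ltW.
apply: (@consistency_compact_neighbourhood C rho) => //.
- exact: compact_norm_ball.
- by move=> theta _ /ltW.
- apply: aeW => x Xx; apply: continuous_in_subspaceT => u; rewrite inE => Cu.
  apply: (convex_continuous_at cT (closs x Xx) rho0) => [i|]; last exact: CT.
  have delta_le : `|rho *: delta_mx 0 i : 'rV[R]_r| <= rho.
    rewrite normrZ ger0_norm ?(ltW rho0)// ler_piMr ?(ltW rho0)//.
    rewrite [leLHS]/Num.norm /= mx_normrE; apply/bigmax_leP; split => // -[a b] _ /=.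
    by rewrite mxE; case: (_ && _); rewrite ?normr1 ?normr0.
  split; apply: near_Theta.
    by rewrite addrAC (le_trans (ler_normD _ _))// mulr_natl mulr2n lerD.
  by rewrite addrAC (le_trans (ler_normB _ _))// mulr_natl mulr2n lerD.
- move=> n w e /andP[e0 e_rho] strict theta Ttheta far.
  pose a := `|theta - thetastar|.
  have a0 : 0 < a by exact: lt_le_trans far.
  have t01 : 0 <= e / a <= 1 by rewrite divr_ge0 ?(ltW e0) ?(ltW a0)//= ler_pdivrMr// mul1r.
  (* The point at distance exactly [e] from [thetastar] on the segment to [theta]; it lies in [C]
     because [e <= rho]. *)
  pose u := e / a *: theta + (1 - e / a) *: thetastar.
  have uE : `|u - thetastar| = e.
    rewrite (_ : u - thetastar = e / a *: (theta - thetastar)).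
      by rewrite normrZ ger0_norm ?(andP t01).1// divfK// gt_eqF.
    by rewrite /u scalerBl scale1r scalerBr -addrA; congr (_ + _); rewrite addrAC subrr add0r.
  have : loss_sum n w thetastar < loss_sum n w u by apply: strict; rewrite ?/C /= uE.
  have : loss_sum n w u <= e / a * loss_sum n w theta + (1 - e / a) * loss_sum n w thetastar.
    rewrite /loss_sum !mulr_sumr -big_split; apply: ler_sum => i _ /=.
    exact: (convex_functionP (closs _ (Xs_in_X i w)) Ttheta Ttstar t01).
  move=> le1 lt1; apply: (lt_of_lt_conv _ (lt_le_trans lt1 le1)).
  by rewrite divr_gt0.
Qed.

End consistency.

Theorem theorem5 (R : realType) (d r : nat)
  (X : set 'rV[R]_d) (Theta : set 'rV[R]_r)
  (m : 'rV[R]_d -> 'M[R]_d)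
  (Pth : 'rV[R]_r -> probability (borel_rV R d) R)
  (p : 'rV[R]_r -> 'rV[R]_d -> R)
  (Q : probability (borel_rV R d) R) (q : 'rV[R]_d -> R)
  (dO : measure_display) (Omega : measurableType dO) (P : probability Omega R)
  (Xs : nat -> {RV P >-> borel_rV R d})
  (thetastar : 'rV[R]_r) (thetahat : nat -> {RV P >-> borel_rV R r})
  (f1 : 'rV[R]_d -> R)
  (openX : open X)
  (p_density : forall theta, Theta theta -> has_density X (Pth theta) (p theta))
  (p_gt0 : forall theta x, Theta theta -> X x -> 0 < p theta x)
  (q_density : has_density X Q q)
  (Xs_in_X : forall i w, X (Xs i w))
  (Xs_iid : iid Q Xs)
  (argmin_dsm :
     argmin Theta (fun theta => dsm X m Q q (p theta)) = [set thetastar])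
  (argmin_risk :
     argmin Theta (fun theta => dsm_risk X m Q (p theta)) = [set thetastar])
  (estimator : min_dsm_estimator m Theta p Xs thetahat)
  (logp_C2 : forall theta, Theta theta -> C2_on X (logd (p theta)))
  (m_C1 : forall i j, C1_on X (fun x => m x i j))
  (grad_le : forall theta, Theta theta ->
     {ae Q, forall x, X x -> norm2 (grad (logd (p theta)) x) <= f1 x})
  (f1_L2 : ((fun x => norm2 (m x)^T * f1 x) \_ X) \in Lfun Q 2%:E)
  (f1_L1 :
     ((fun x => norm2 (div_mx (fun y => m y *m (m y)^T) x) * f1 x) \_ X)
       \in Lfun Q 1%:E)
  (hess_le : forall C : set 'rV[R]_r, compact C -> C `<=` Theta ->
     exists f2 : 'rV[R]_d -> R,
       (forall theta, C theta ->
          {ae Q, forall x, X x -> norm2 (hess (logd (p theta)) x) <= f2 x}) /\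
       ((fun x => `|m x *m (m x)^T| * f2 x) \_ X) \in Lfun Q 1%:E)
  (compact_or_convex :
     (compact Theta /\
      {ae Q, forall x, X x ->
         {within Theta, continuous (fun theta => dsm_loss m (p theta) x)}}) \/
     [/\ @convex_set R 'rV[R]_r Theta,
         (forall x, X x ->
            @convex_function R 'rV[R]_r Theta
              (fun theta => dsm_loss m (p theta) x)) &
         Theta° thetastar]) :
  cvg_in_probability thetahat thetastar.
Proof.
case: compact_or_convex => [[cT contT]|[cT closs int_star]].
  exact: (consistency_compact openX Xs_in_X Xs_iid argmin_risk estimator
    logp_C2 m_C1 grad_le f1_L2 f1_L1 hess_le cT contT).
exact: (consistency_convex openX Xs_in_X Xs_iid argmin_risk estimator
  logp_C2 m_C1 grad_le f1_L2 f1_L1 hess_le cT closs int_star).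
Qed.
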